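(* (1) For $n\geq 4$, $e_3(n,2,n-2)=n$. (2) For $n\geq 4$, $$e_3(n,3,n-2)=\begin{cases} n+1 & \text{if } n=4,\\ n & \text{if } n=5,\\ n-1 & \text{if } n\geq 6.\end{cases}$$ (3) For $n\geq 5$ and $4\leq \ell\leq n-1$, $e_3(n,\ell,n-2)=n-1$.
   Context: All graphs are undirected, finite and simple. For a graph $G$ and a nonempty set $S\subseteq V(G)$, the Steiner distance $d_G(S)$ is the minimum number of edges of a connected subgraph (equivalently, a subtree) of $G$ whose vertex set contains $S$; set $d_G(S)=\infty$ if there is none. The Steiner $3$-diameter is $sdiam_3(G)=\max\{d_G(S): S\subseteq V(G),\ |S|=3\}$. For natural numbers $n,\ell,d$ with $d<n$, $\ell<n$, let $\mathscr{H}_3(n,\ell,d)$ be the set of all graphs $G$ of order $n$ with maximum degree exactly $\ell$ and $sdiam_3(G)\leq d$. Put $e_3(n,\ell,d)=\min\{|E(G)|: G\in \mathscr{H}_3(n,\ell,d)\}$, with $e_3(n,\ell,d)=\infty$ if $\mathscr{H}_3(n,\ell,d)=\emptyset$. *)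

(* Defs.v *)
From HB Require Import structures.
From mathcomp Require Import all_boot all_order all_algebra.
From mathcomp Require Import constructive_ereal.

Set Implicit Arguments.
Unset Strict Implicit.
Unset Printing Implicit Defensive.

Import Order.TTheory GRing.Theory Num.Theory.

(* Values in N \cup {oo} live in \bar int, whose total order and +oo serve
   for minima over possibly empty families. *)

Record sgraph (V : finType) := SGraph {
  edges : {set {set V}};
  edgesP : [forall e in edges, #|e| == 2]
}.

HB.instance Definition _ (V : finType) := [isSub for @edges V].
HB.instance Definition _ (V : finType) := [Finite of sgraph V by <:].

Definition adj (V : finType) (E : {set {set V}}) : rel V :=
  [rel x y | [set x; y] \in E].

Definition degree (V : finType) (G : sgraph V) (x : V) : nat :=
  #|[set y | adj (edges G) x y]|.

Definition maxdeg (V : finType) (G : sgraph V) : nat :=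
  \max_(x : V) degree G x.

(* A pair (W, F) stands for a graph with vertex set W and edge set F. *)
Definition subgraph (V : finType) (G : sgraph V)
    (W : {set V}) (F : {set {set V}}) : bool :=
  (F \subset edges G) && [forall e in F, e \subset W].

Definition connected_on (V : finType) (W : {set V}) (F : {set {set V}}) : bool :=
  [forall x in W, forall y in W, connect (adj F) x y].

Definition steiner_dist (V : finType) (G : sgraph V) (S : {set V}) : \bar int :=
  \big[Order.min/+oo%E]_(H : {set V} * {set {set V}} |
      [&& subgraph G H.1 H.2, connected_on H.1 H.2 & S \subset H.1])
    (#|H.2|%:Z)%:E.

Definition sdiam (k : nat) (V : finType) (G : sgraph V) : \bar int :=
  \big[Order.max/-oo%E]_(S : {set V} | #|S| == k) steiner_dist G S.

(* Graphs of order n are taken, up to isomorphism, on the vertex set 'I_n. *)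
Definition H3 (n l d : nat) : {set sgraph 'I_n} :=
  [set G | (maxdeg G == l) && (sdiam 3 G <= (d%:Z)%:E)%E].

Definition e3 (n l d : nat) : \bar int :=
  \big[Order.min/+oo%E]_(G in H3 n l d) (#|edges G|%:Z)%:E.

(* Main.v *)
(* Lower bounds: a graph with finite Steiner 3-diameter is connected, so it has
   at least n - 1 edges. If it has exactly n - 1 edges it is a tree, and a
   connected subgraph containing all the leaves of a tree is the whole tree; so
   sdiam_3 <= n - 2 forces at least 4 leaves, which the degree sum 2(n - 1)
   excludes when the maximum degree is 2, or is 3 and n <= 5. For n = 4 and
   maximum degree 3, the three neighbours of a vertex of degree 3 must be
   connected among themselves, which gives 3 + 2 edges.
   Upper bounds: if G - v is connected for 4 vertices v, then every 3-set avoids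
   one of them and lies in a spanning tree of G - v, which has n - 2 edges. *)
Require Import Defs.
From HB Require Import structures.
From mathcomp Require Import all_boot all_order all_algebra.
From mathcomp Require Import constructive_ereal zify.

Set Implicit Arguments.
Unset Strict Implicit.
Unset Printing Implicit Defensive.

(** * Degrees, cuts and the size of connected graphs *)

Lemma adj_sym (V : finType) (E : {set {set V}}) : symmetric (adj E).
Proof. by move=> x y; rewrite /adj /= setUC. Qed.

Lemma card_edge (V : finType) (G : sgraph V) e : e \in edges G -> #|e| = 2.
Proof. by move=> eG; apply/eqP/(forall_inP (edgesP G)). Qed.

Lemma degreeE (V : finType) (G : sgraph V) (x : V) :
  degree G x = #|[set e in edges G | x \in e]|.
Proof.
rewrite /degree.
have inj : {in [set y | adj (edges G) x y] &, injective (fun y => [set x; y])}.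
  move=> y z; rewrite !inE /adj /= => xy xz eq_yz.
  have yx : y != x.
    by apply/eqP => yx; move: (card_edge xy); rewrite yx setUid cards1.
  by have := set22 x y; rewrite eq_yz !inE (negPf yx) => /eqP.
rewrite -(card_in_imset inj); congr #|pred_of_set _|; apply/setP => e.
apply/imsetP/setIdP => [[y]|[eG xe]].
  by rewrite inE /adj /= => xy ->; rewrite set21.
have /cards1P [y ey] : #|e :\ x| == 1%N.
  by have := cardsD1 x e; rewrite xe (card_edge eG) => -[e1]; apply/eqP.
have -> : e = [set x; y] by rewrite -(setD1K xe) ey.
by exists y; rewrite // inE /adj /= -ey setD1K.
Qed.

(** Double counting of incidences. For [U] the whole vertex set it is the handshake lemma; for
    smaller [U] it separates the edges by how far they enter [U]. *)
Lemma sum_degree (V : finType) (G : sgraph V) (U : {set V}) :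
  \sum_(x in U) degree G x = \sum_(e in edges G) #|e :&: U|.
Proof.
under eq_bigr => x _ do rewrite degreeE -sum1dep_card big_mkcondr /=.
rewrite exchange_big /=; apply: eq_bigr => e _.
rewrite -sum1_card -big_mkcondr /=; apply: eq_bigl => x.
by rewrite inE andbC.
Qed.

Lemma degree_le_maxdeg (V : finType) (G : sgraph V) (x : V) :
  degree G x <= maxdeg G.
Proof. exact: (@leq_bigmax_cond _ xpredT). Qed.

(** A path from [x] to [y] has a first step that leaves [A]. *)
Lemma connected_on_cut (V : finType) (W A : {set V}) (F : {set {set V}}) x y :
  connected_on W F -> x \in W -> y \in W -> x \in A -> y \notin A ->
  exists2 u, u \in A & exists2 v, v \notin A & [set u; v] \in F.
Proof.
move=> /forall_inP cW xW yW xA yA.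
have /forall_inP/(_ y yW)/connectP [p pp ey] := cW x xW.
move: yA; rewrite {}ey.
elim: p x xA pp {xW} => [|z p IHp] x xA /= => [_ /negP//|/andP [xz pz]].
by case: (boolP (z \in A)) => [/IHp/(_ pz)//|zA _]; exists x => //; exists z.
Qed.

(** A vertex set is grown from a root one vertex at a time: while part of [W] lies outside it, a cut
    edge supplies both a new vertex and an edge not yet counted. *)
Lemma connected_card_le (V : finType) (W : {set V}) (F : {set {set V}}) :
  connected_on W F -> (forall e, e \in F -> e \subset W) -> #|W| <= #|F|.+1.
Proof.
move=> cW FW; have [->|[r rW]] := set_0Vmem W; first by rewrite cards0.
have W_gt0 : 0 < #|W| by apply/card_gt0P; exists r.
suff grow k : k < #|W| -> exists2 A : {set V}, r \in A &
    #|A| = k.+1 /\ k <= #|[set e in F | e \subset A]|.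
  have := ltnSn #|W|.-1; rewrite {2}prednK // => /grow [A _ [_ leF]].
  rewrite -(prednK W_gt0) ltnS (leq_trans leF) // subset_leq_card //.
  by apply/subsetP => e /setIdP [].
elim: k => [_|k IHk ltk]; first by exists [set r]; rewrite ?set11 // cards1.
have [A rA [cardA leA]] := IHk (ltnW ltk).
have /subsetPn [y yW yA] : ~~ (W \subset A).
  by apply/negP => /subset_leq_card; rewrite cardA leqNgt ltk.
have [u uA [v vA uvF]] := connected_on_cut cW rW yW rA yA.
exists (v |: A); first by rewrite !inE rA orbT.
split; first by rewrite cardsU1 vA cardA.
rewrite (leq_ltn_trans leA) // proper_card //; apply/properP; split.
  apply/subsetP => e /setIdP [eF eA]; rewrite inE eF /=.
  exact: subset_trans eA (subsetUr _ _).
exists [set u; v]; rewrite !inE uvF /=.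
  by rewrite subUset !sub1set !inE uA eqxx orbT.
by rewrite subUset !sub1set uA (negPf vA).
Qed.

(** * Finite bounds on the Steiner distance and diameter *)

Lemma steiner_dist_leP (V : finType) (G : sgraph V) (S : {set V}) (d : nat) :
  reflect (exists W F, [/\ subgraph G W F, connected_on W F, S \subset W &
             #|F| <= d])
    (steiner_dist G S <= (d%:Z)%:E)%E.
Proof.
apply: (iffP idP) => [|[W [F [sG cW SW leF]]]].
  pose ok (H : {set V} * {set {set V}}) :=
    [&& subgraph G H.1 H.2, connected_on H.1 H.2, S \subset H.1 & #|H.2| <= d].
  case: (pickP ok) => [[W F] /and4P [? ? ? ?] _|noH]; first by exists W, F.
  (* Without a pair of at most [d] edges, all terms of the minimum and its default [+oo] exceed
     [d]. *)
  rewrite Order.TotalTheory.leNgt => /negP [].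
  apply/Order.TotalTheory.bigmin_gtP; split=> [|H /and3P [sG cW SW]].
    exact: ltry.
  rewrite lte_fin ltz_nat ltnNge; apply/negP => leF.
  by have := noH H; rewrite /ok sG cW SW leF.
apply: (@Order.TotalTheory.bigmin_inf _ _ _ _ (W, F)) => /=; first by apply/and3P.
by rewrite lee_fin lez_nat.
Qed.

Lemma sdiam_leP (k d : nat) (V : finType) (G : sgraph V) :
  reflect (forall S : {set V}, #|S| = k -> (steiner_dist G S <= (d%:Z)%:E)%E)
    (sdiam k G <= (d%:Z)%:E)%E.
Proof.
apply: (iffP (Order.TotalTheory.bigmax_leP _ _ _ _)) => [[_ dS] S /eqP/dS //|dS].
by split=> [|S /eqP/dS //]; rewrite leNye.
Qed.

(** * Lower bounds on the number of edges *)

Lemma superset_card (V : finType) (A : {set V}) k :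
  #|A| <= k <= #|V| -> exists2 S : {set V}, A \subset S & #|S| = k.
Proof.
elim: k => [|k IHk] /andP [leAk lekV]; first by exists A; rewrite ?subxx //; lia.
have [eqAk|neAk] := eqVneq #|A| k.+1; first by exists A.
have [S AS cardS] : exists2 S : {set V}, A \subset S & #|S| = k.
  by apply: IHk; lia.
have /subsetPn [x _ xS] : ~~ ([set: V] \subset S).
  by apply/negP => /subset_leq_card; rewrite cardsT; lia.
exists (x |: S); last by rewrite cardsU1 xS cardS.
exact: subset_trans AS (subsetUr _ _).
Qed.

(** [sdiam 3] speaks only of sets of exactly three vertices, so [A] is first enlarged to such a set;
    this is also the source of [3 <= #|W|]. *)
Lemma subtree_containing (V : finType) (G : sgraph V) (d : nat) (A : {set V}) :
  3 <= #|V| -> (sdiam 3 G <= (d%:Z)%:E)%E -> #|A| <= 3 ->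
  exists (W : {set V}) (F : {set {set V}}), [/\ F \subset edges G,
    forall e, e \in F -> e \subset W, connected_on W F, A \subset W &
    3 <= #|W| /\ #|F| <= d].
Proof.
move=> V_ge3 sdiamG A_le3; have [|S AS S3] := @superset_card V A 3; first by rewrite A_le3.
have /sdiam_leP/(_ S S3)/steiner_dist_leP := sdiamG.
move=> [W [F [/andP [FG /forall_inP FW] cW SW leF]]].
by exists W, F; split=> //; [apply: subset_trans SW|rewrite -S3 subset_leq_card].
Qed.

Lemma sdiam3_connected (V : finType) (G : sgraph V) (d : nat) :
  3 <= #|V| -> (sdiam 3 G <= (d%:Z)%:E)%E ->
  connected_on [set: V] (edges G).
Proof.
move=> V_ge3 sdiamG; apply/forall_inP => x _; apply/forall_inP => y _.
have [|W [F [FG _ cW]]] := @subtree_containing _ _ _ [set x; y] V_ge3 sdiamG.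
  by rewrite cards2; case: (_ != _).
rewrite subUset !sub1set => /andP [xW yW] _.
have := forall_inP (forall_inP cW x xW) y yW.
by apply: connect_sub => u v uvF; apply: connect1; apply: (subsetP FG).
Qed.

Lemma sdiam3_card_edges_ge (V : finType) (G : sgraph V) (d : nat) :
  3 <= #|V| -> (sdiam 3 G <= (d%:Z)%:E)%E -> #|V|.-1 <= #|edges G|.
Proof.
move=> V_ge3 sdiamG.
have := connected_card_le (sdiam3_connected V_ge3 sdiamG) (fun e _ => subsetT e).
by rewrite cardsT; lia.
Qed.

(* A connected subgraph (W, F) through all the leaves of a tree is the whole
   tree: the vertices of the complement U of W have degree at least 2, so there
   are at least |U| + 1 edges outside F, while |F| >= |W| - 1. *)
Lemma sdiam3_leaves_ge4 (V : finType) (G : sgraph V) (d : nat) :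
  3 <= #|V| -> (sdiam 3 G <= (d%:Z)%:E)%E ->
  d <= #|V| - 2 -> #|edges G| = #|V|.-1 ->
  4 <= #|[set x | degree G x <= 1]|.
Proof.
move=> V_ge3 sdiamG led treeG; rewrite leqNgt; apply/negP; rewrite ltnS => leaf3.
have [W [F [FG FW cW leafW [W3 leF]]]] := subtree_containing V_ge3 sdiamG leaf3.
have leW := connected_card_le cW FW.
have cardWU := cardsC W.
(* [F] has at most [#|V| - 2] edges, too few to span all vertices. *)
have /card_gt0P [y] : 0 < #|~: W| by lia.
rewrite inE => yW.
have /card_gt0P [x xW] : 0 < #|W| by lia.
have [u uW [v vW uvG]] :=
  connected_on_cut (sdiam3_connected V_ge3 sdiamG) (in_setT x) (in_setT y) xW yW.
have degU : 2 * #|~: W| <= \sum_(x in ~: W) degree G x.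
  rewrite mulnC -sum_nat_const; apply: leq_sum => z; rewrite inE => zW.
  rewrite ltnNge; apply: contra zW => degz; apply: (subsetP leafW).
  by rewrite inE.
have uvF : [set u; v] \in edges G :\: F.
  rewrite inE uvG andbT; apply/negP => /FW.
  by rewrite subUset !sub1set (negPf vW) andbF.
(* Edges of [F] miss the complement of [W], and each other edge contributes at most 2. The cut edge
   contributes only 1, whence the predecessor, which yields the extra edge. *)
have sumU : \sum_(x in ~: W) degree G x <= (2 * #|edges G :\: F|).-1.
  rewrite sum_degree (big_setID F) /= big1 ?add0n => [|e /setIP [_ eF]]; last first.
    apply/eqP; rewrite cards_eq0 setI_eq0 disjoint_sym.
    by rewrite disjoints_subset setCS FW.
  rewrite (big_setD1 _ uvF) /= [_ :&: _](_ : _ = [set v]); last first.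
    apply/setP => z; rewrite !inE.
    case: eqP => [->|_] /=; last by case: eqP => [->|].
    by rewrite uW; apply/esym/eqP => uv; rewrite -uv uW in vW.
  rewrite cards1 (cardsD1 [set u; v]) uvF add1n mulnS.
  rewrite (_ : _.-1 = (2 * #|(edges G :\: F) :\ [set u; v]|).+1) // ltnS.
  rewrite mulnC -sum_nat_const; apply: leq_sum => e /setD1P [_ /setDP [eG _]].
  by rewrite -(card_edge eG) subset_leq_card // subsetIl.
have := cardsID F (edges G); rewrite (setIidPr FG).
have : 0 < #|edges G :\: F| by apply/card_gt0P; exists [set u; v].
lia.
Qed.

(** The last hypothesis says that four vertices of degree 1 and all others of maximum degree cannot
    reach the degree sum of a tree. It holds at maximum degree 2 for every order, and at 3 for
    orders 4 and 5. *)
Lemma sdiam3_card_edges_gt (V : finType) (G : sgraph V) :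
  4 <= #|V| -> (sdiam 3 G <= ((#|V| - 2)%:Z)%:E)%E -> 0 < maxdeg G ->
  maxdeg G * (#|V| - 4) + 4 < 2 * #|V|.-1 -> #|V| <= #|edges G|.
Proof.
move=> V4 sG l_gt0 ltl; have V3 : 3 <= #|V| by lia.
have := sdiam3_card_edges_ge V3 sG; rewrite leq_eqVlt.
case/orP => [/eqP/esym tree|]; last by lia.
have leaf4 := sdiam3_leaves_ge4 V3 sG (leqnn _) tree.
set L := [set x | _] in leaf4.
have degV : \sum_(x in [set: V]) degree G x = 2 * #|edges G|.
  rewrite sum_degree mulnC -sum_nat_const; apply: eq_bigr => e eG.
  by rewrite setIT (card_edge eG).
have degL : \sum_(x in L) degree G x <= #|L|.
  by rewrite -sum1_card; apply: leq_sum => x; rewrite inE.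
have degLC : \sum_(x in ~: L) degree G x <= #|~: L| * maxdeg G.
  by rewrite -sum_nat_const; apply: leq_sum => x _; apply: degree_le_maxdeg.
have cardL := cardsC L.
move: degV; rewrite (big_setID L) /= setTI setTD tree => degV.
(* As [maxdeg G] is positive, the left side does not increase with [#|L|], so the worst case is
   [#|L| = 4]. *)
have : #|~: L| * maxdeg G + #|L| <= maxdeg G * (#|V| - 4) + 4; last by lia.
nia.
Qed.

Lemma sdiam3_order4 (V : finType) (G : sgraph V) :
  #|V| = 4 -> (sdiam 3 G <= (2%:Z)%:E)%E -> maxdeg G = 3 -> 5 <= #|edges G|.
Proof.
move=> V4 sG degG; have V3 : 3 <= #|V| by rewrite V4.
have [|c cG] := eq_bigmax (degree G); first by rewrite V4.
have [|W [F [FG FW cW SW [_ leF]]]] := subtree_containing V3 sG (A := ~: [set c]).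
  by have := cardsC [set c]; rewrite cards1; lia.
have leW := connected_card_le cW FW.
(* If [c] were in [W], then [W] would be all four vertices and need three edges. *)
have cW' : c \notin W.
  apply/negP => cW1; suff W1 : W = [set: V] by rewrite W1 cardsT in leW; lia.
  apply/setP => x; rewrite inE; have [->//|xc] := eqVneq x c.
  by rewrite (subsetP SW) // !inE.
have W3 : 3 <= #|W|.
  by have := subset_leq_card SW; have := cardsC [set c]; rewrite cards1; lia.
have := cardsID F (edges G); rewrite (setIidPr FG).
have : 3 <= #|edges G :\: F|; last by lia.
rewrite -degG /maxdeg cG degreeE subset_leq_card //.
apply/subsetP => e /setIdP [eG ce]; rewrite inE eG andbT.
by apply: contra cW' => /FW/subsetP/(_ c ce).
Qed.

(** * Values of [e3] from a witness, and Steiner trees avoiding a vertex *)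

Lemma H3P (n l d : nat) (G : sgraph 'I_n) :
  reflect (maxdeg G = l /\ (sdiam 3 G <= (d%:Z)%:E)%E) (G \in H3 n l d).
Proof. by rewrite inE; apply: (iffP andP) => -[/eqP]. Qed.

Lemma e3_eq (n l d m : nat) (G : sgraph 'I_n) :
  (forall G' : sgraph 'I_n, maxdeg G' = l -> (sdiam 3 G' <= (d%:Z)%:E)%E ->
     m <= #|edges G'|) ->
  maxdeg G = l -> (sdiam 3 G <= (d%:Z)%:E)%E -> #|edges G| <= m ->
  e3 n l d = (m%:Z)%:E.
Proof.
move=> minm degG sG leG; apply: Order.POrderTheory.le_anti; apply/andP; split.
  apply: (@Order.TotalTheory.bigmin_inf _ _ _ _ G); first exact/H3P.
  by rewrite lee_fin lez_nat.
apply/Order.TotalTheory.bigmin_geP; split=> [|G' /H3P [degG' sG']].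
  exact: leey.
by rewrite lee_fin lez_nat minm.
Qed.

(** Each vertex other than [v] and [r] chooses a neighbour of lower rank. Following the choices
    leads to [r], so the chosen edges, at most one per choosing vertex, connect everything except
    [v]. *)
Lemma steiner_dist_avoid (V : finType) (G : sgraph V) (S : {set V}) (v r : V)
    (rk : V -> nat) :
  v \notin S -> r != v ->
  (forall x, x != v -> x != r ->
     exists y, [/\ y != v, adj (edges G) x y & rk y < rk x]) ->
  (steiner_dist G S <= ((#|V| - 2)%:Z)%:E)%E.
Proof.
move=> vS rv par.
pose pr x y := [&& y != v, adj (edges G) x y & rk y < rk x].
pose p x := odflt x [pick y | pr x y].
have pP x : x != v -> x != r -> pr x (p x).
  move=> xv xr; rewrite /p; case: pickP => //= nopr.
  by have [y [? ? ?]] := par x xv xr; have := nopr y; rewrite /pr; move/and3P; case.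
apply/steiner_dist_leP; exists (~: [set v]), [set [set x; p x] | x in ~: [set v; r]].
have connr x : x != v -> connect (adj [set [set x; p x] | x in ~: [set v; r]]) x r.
  have [k] := ubnP (rk x); elim: k x => // k IHk x ltk xv.
  have [->|xr] := eqVneq x r; first exact: connect0.
  have /and3P [pv _ ltp] := pP x xv xr.
  apply: connect_trans (IHk _ (leq_trans ltp ltk) pv).
  by apply/connect1/imset_f; rewrite !inE negb_or xv.
split.
- apply/andP; split.
    apply/subsetP => e /imsetP [x]; rewrite !inE negb_or => /andP [xv xr] ->.
    by have /and3P [] := pP x xv xr.
  apply/forall_inP => e /imsetP [x]; rewrite !inE negb_or => /andP [xv xr] ->.
  by have /and3P [pv _ _] := pP x xv xr; rewrite subUset !sub1set !inE xv.
- apply/forall_inP => x; rewrite !inE => xv; apply/forall_inP => y; rewrite !inE => yv.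
  apply: connect_trans (connr x xv) _.
  by rewrite (sym_connect_sym (@adj_sym _ _)) connr.
- by apply/subsetP => x xS; rewrite !inE; apply: contraNneq vS => <-.
- apply: leq_trans (leq_imset_card _ _) _.
  by have := cardsC [set v; r]; rewrite cards2 eq_sym rv; lia.
Qed.

(** * Concrete graphs from lists of pairs of numbers *)

Definition nat_edge n (u : nat * nat) : {set 'I_n} :=
  [set x : 'I_n | (x == u.1 :> nat) || (x == u.2 :> nat)].

(** The cardinality filter discards loops and pairs with an entry outside ['I_n]. *)
Definition list_edges n (s : seq (nat * nat)) : {set {set 'I_n}} :=
  [set e in [seq nat_edge n u | u <- s] | #|e| == 2].

Lemma list_edgesP n s : [forall e in list_edges n s, #|e| == 2].
Proof. by apply/forall_inP => e /setIdP []. Qed.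

Definition list_graph n s : sgraph 'I_n := SGraph (list_edgesP n s).

Definition list_adj (s : seq (nat * nat)) (i j : nat) : bool :=
  (i != j) && (((i, j) \in s) || ((j, i) \in s)).

Lemma card_list_edges n s : #|edges (list_graph n s)| <= size s.
Proof.
rewrite -(size_map (nat_edge n)) (leq_trans _ (card_size _)) // subset_leq_card //.
by apply/subsetP => e /setIdP [].
Qed.

Lemma list_graph_adj n s (x y : 'I_n) :
  adj (edges (list_graph n s)) x y = list_adj s x y.
Proof.
rewrite /adj /= inE cards2 /list_adj eqSS eqb1 andbC.
rewrite -val_eqE /=; apply: andb_id2l => xy; apply/mapP/orP => [[[a b] ab_s eq_e]|].
  have := set21 x y; have := set22 x y; rewrite eq_e !inE /= => yab xab.
  have [[xa yb]|[xb ya]] : (x = a :> nat /\ y = b :> nat) \/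
      (x = b :> nat /\ y = a :> nat) by lia.
    by left; rewrite xa yb.
  by right; rewrite xb ya.
case=> [xy_s|yx_s]; [exists (val x, val y)|exists (val y, val x)] => //.
  by apply/setP => z; rewrite !inE -!val_eqE.
by apply/setP => z; rewrite !inE -!val_eqE orbC.
Qed.

Lemma degree_list_le n s (x : 'I_n) (t : seq nat) :
  (forall j, j < n -> list_adj s x j -> j \in t) ->
  degree (list_graph n s) x <= size t.
Proof.
move=> adj_t; rewrite /degree cardE -(size_map val).
apply: uniq_leq_size; first by rewrite (map_inj_uniq val_inj) enum_uniq.
move=> _ /mapP [y + ->]; rewrite mem_enum inE list_graph_adj.
exact: adj_t.
Qed.

Lemma degree_list_ge n s (x : 'I_n) (t : seq nat) :
  uniq t -> (forall j, j \in t -> (j < n) && list_adj s x j) ->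
  size t <= degree (list_graph n s) x.
Proof.
move=> uniq_t adj_t; rewrite /degree cardE -(size_map val).
apply: uniq_leq_size => // j jt; have /andP [ltjn xj] := adj_t j jt.
by apply/mapP; exists (Ordinal ltjn); rewrite // mem_enum inE list_graph_adj.
Qed.

Lemma maxdeg_list n s i (t : seq nat) :
  i < n -> uniq t -> (forall j, j \in t -> (j < n) && list_adj s i j) ->
  (forall k, k < n -> exists2 t', size t' <= size t &
     forall j, j < n -> list_adj s k j -> j \in t') ->
  maxdeg (list_graph n s) = size t.
Proof.
move=> ltin uniq_t adj_t deg_le; apply/eqP; rewrite eqn_leq; apply/andP; split.
  apply/bigmax_leqP => x _; have [t' let' adj_t'] := deg_le x (ltn_ord x).
  exact: leq_trans (degree_list_le adj_t') let'.
apply: leq_trans (degree_le_maxdeg _ (Ordinal ltin)).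
exact: degree_list_ge.
Qed.

(* rk is the height in a spanning tree, rooted at r, of the graph minus v. *)
Definition connected_without n s v :=
  exists2 r, r < n /\ r != v & exists rk : nat -> nat,
    forall i, i < n -> i != v -> i != r ->
      exists j, [/\ j < n, j != v, list_adj s i j & rk j < rk i].

Lemma sdiam_list n s (t : seq nat) :
  uniq t -> size t = 4 ->
  (forall v, v \in t -> v < n /\ connected_without n s v) ->
  (sdiam 3 (list_graph n s) <= ((n - 2)%:Z)%:E)%E.
Proof.
move=> uniq_t t4 noncut; apply/sdiam_leP => S S3.
have [v vt vS] : exists2 v, v \in t & v \notin [seq val x | x <- enum S].
  apply/hasP; rewrite -[has _ _]negbK -all_predC; apply/negP => /allP tS.
  have : size t <= size [seq val x | x <- enum S].
    by apply: uniq_leq_size => // v /tS /=; rewrite negbK.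
  by rewrite size_map -cardE S3 t4.
have [ltvn [r [ltrn rv] [rk par]]] := noncut v vt.
rewrite -[X in (X - 2)%N](card_ord n).
apply: (@steiner_dist_avoid _ _ _ (Ordinal ltvn) (Ordinal ltrn) (fun x => rk x)) => //.
  by apply: contra vS => vS; apply/mapP; exists (Ordinal ltvn); rewrite ?mem_enum.
move=> x; rewrite -!val_eqE /= => xv xr.
have [j [ltjn jv xj ltj]] := par x (ltn_ord x) xv xr.
by exists (Ordinal ltjn); rewrite list_graph_adj -val_eqE.
Qed.

Ltac lia_if :=
  rewrite ?inE;
  repeat match goal with
  | |- context [if ?b then _ else _] => destruct b eqn:?
  | H : context [if ?b then _ else _] |- _ => destruct b eqn:?
  end; lia.

(** * Maximum degree 2: the cycle *)

Definition cycle_list n := (0, n.-1) :: [seq (i, i.+1) | i <- iota 0 n.-1].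

Lemma cycle_adj n i j : i < n -> j < n ->
  list_adj (cycle_list n) i j =
  (i != j) && [|| j == i.+1, i == j.+1, (i == 0) && (j == n.-1)
                | (j == 0) && (i == n.-1)].
Proof.
have step a b : ((a, b) \in [seq (i, i.+1) | i <- iota 0 n.-1]) =
    (a < n.-1) && (b == a.+1).
  apply/mapP/andP => [[c]|[lta /eqP ->]]; last by exists a; rewrite // mem_iota.
  by rewrite mem_iota => ? [-> ->].
by rewrite /list_adj !inE !step !xpair_eqE; lia.
Qed.

Lemma cycle_connected_without n v : 4 <= n -> v < n ->
  connected_without n (cycle_list n) v.
Proof.
(* The cycle minus [v] is a path. Its root is the successor of [v], the rank of [i] is the number of
   steps from [v] round to [i], and the parent is the cyclic predecessor. *)
move=> n4 ltvn; exists (if v == n.-1 then 0 else v.+1); first by lia_if.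
exists (fun i => if v < i then i - v else i + n - v) => i ltin iv ir.
exists (if i == 0 then n.-1 else i.-1).
by rewrite cycle_adj; first split; lia_if.
Qed.

Lemma e3_2 n : 4 <= n -> e3 n 2 (n - 2) = (n%:Z)%:E.
Proof.
move=> n4; apply: (e3_eq (G := list_graph n (cycle_list n))).
- move=> G degG sG; have := @sdiam3_card_edges_gt _ G.
  by rewrite card_ord degG; apply=> //; lia.
- apply: (@maxdeg_list n _ 0 [:: 1; n.-1]) => /=; [lia|rewrite inE; lia| |].
    by move=> j; rewrite !inE => ?; rewrite cycle_adj; lia.
  move=> k ltk.
  exists [:: if k == 0 then n.-1 else k.-1; if k == n.-1 then 0 else k.+1] => // j ltj.
  by rewrite cycle_adj //; lia_if.
- apply: (@sdiam_list n _ [:: 0; 1; 2; 3]) => // v.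
  rewrite !inE => ?; have ltv : v < n by lia.
  by split=> //; apply: cycle_connected_without.
- by apply: leq_trans (card_list_edges _ _) _; rewrite /= size_map size_iota; lia.
Qed.

(** * Trees given by a parent function; caterpillars *)

Definition tree_list n p : seq (nat * nat) := [seq (i, p i) | i <- iota 1 n.-1].

Lemma tree_adj n p i j : list_adj (tree_list n p) i j =
  (i != j) && ((0 < i < n) && (j == p i) || (0 < j < n) && (i == p j)).
Proof.
have step a b : ((a, b) \in tree_list n p) = (0 < a < n) && (b == p a).
  apply/mapP/andP => [[c]|[lta /eqP ->]]; last by exists a; rewrite // mem_iota; lia.
  by rewrite mem_iota => ? [-> ->]; rewrite eqxx; lia.
by rewrite /list_adj !step.
Qed.

(** A vertex that is nobody's parent is a leaf, so every other vertex keeps its parent; since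
    parents are smaller, the index itself serves as rank. *)
Lemma tree_connected_without n p v :
  (forall i, 0 < i -> p i < i) -> 0 < v < n -> (forall i, 0 < i < n -> p i != v) ->
  connected_without n (tree_list n p) v.
Proof.
move=> ltp v_n leaf; exists 0; first by lia.
exists id => i ltin iv i0; have i_gt0 : 0 < i by lia.
exists (p i); have := ltp i i_gt0; rewrite tree_adj eqxx.
by split; [lia|apply: leaf; lia|lia|].
Qed.

(* Parent function of a caterpillar rooted at 0, with spine 0, a, b, b + 1, ...
   and further leaves 1, .., a - 1 at 0 and a + 1, .., b - 1 at a. *)
Definition caterpillar a b i := if i <= a then 0 else if i <= b then a else i.-1.

Lemma maxdeg_caterpillar n a b :
  3 <= a < n -> a <= b <= a.+2 ->
  maxdeg (list_graph n (tree_list n (caterpillar a b))) = a.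
Proof.
move=> /andP [a3 ltan] b_a.
rewrite -[RHS](size_iota 1); apply: (@maxdeg_list n _ 0); [lia|exact: iota_uniq| |].
  by move=> j; rewrite mem_iota tree_adj /caterpillar; lia_if.
move=> k ltk; rewrite size_iota.
have [->|k0] := eqVneq k 0.
  exists (iota 1 a) => [|j ltj]; first by rewrite size_iota.
  by rewrite tree_adj mem_iota /caterpillar; lia_if.
(* Apart from 0, a vertex has its parent and at most one child, except that [a] may have the two
   children [a.+1] and [a.+2]. Three neighbours are allowed as [3 <= a]. *)
exists [:: caterpillar a b k; k.+1; if k == a then a.+2 else k.+1] => // j ltj.
by rewrite tree_adj !inE /caterpillar; lia_if.
Qed.

Lemma e3_tree n a b t : 3 <= a < n -> a <= b <= a.+2 ->
  uniq t -> size t = 4 ->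
  (forall v, v \in t -> 0 < v < n /\
     forall i, 0 < i < n -> caterpillar a b i != v) ->
  e3 n a (n - 2) = ((n - 1)%N%:Z)%:E.
Proof.
move=> a_n b_a uniq_t t4 leaf.
apply: (e3_eq (G := list_graph n (tree_list n (caterpillar a b)))).
- move=> G degG sG; have := sdiam3_card_edges_ge _ sG.
  by rewrite card_ord subn1; apply; lia.
- exact: maxdeg_caterpillar.
- apply: (@sdiam_list n _ t) => // v /leaf [v_n vleaf]; split; first by lia.
  by apply: tree_connected_without => // i; rewrite /caterpillar; lia_if.
- by apply: leq_trans (card_list_edges _ _) _; rewrite size_map size_iota; lia.
Qed.

Lemma e3_ge4 n l : 4 <= l <= n - 1 -> e3 n l (n - 2) = ((n - 1)%N%:Z)%:E.
Proof.
(* The vertices 1, 2, 3 hang at 0 because [4 <= l], and [n.-1] ends the spine; for [l = n - 1] the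
   tree is a star. *)
move=> l_n; apply: (@e3_tree n l l [:: 1; 2; 3; n.-1]); [lia|lia| |by []|].
  by rewrite /= !inE; lia.
by move=> v; rewrite !inE => v_t; split=> [|i]; rewrite /caterpillar; lia_if.
Qed.

Lemma e3_3_ge6 n : 6 <= n -> e3 n 3 (n - 2) = ((n - 1)%N%:Z)%:E.
Proof.
(* Both 0 and 3 have degree 3: the leaves 1, 2 hang at 0, the leaf 4 at 3, and the spine runs on
   from 5 to its end [n.-1]. *)
move=> n6; apply: (@e3_tree n 3 5 [:: 1; 2; 4; n.-1]); [lia|lia| |by []|].
  by rewrite /= !inE; lia.
by move=> v; rewrite !inE => v_t; split=> [|i]; rewrite /caterpillar; lia_if.
Qed.

(** * Maximum degree 3 on four and five vertices *)

Lemma e3_3_4 : e3 4 3 2 = (5%:Z)%:E.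
Proof.
(* The complete graph without the edge between 1 and 3. *)
pose s := [:: (0, 1); (0, 2); (0, 3); (1, 2); (2, 3)].
apply: (e3_eq (G := list_graph 4 s)).
- by move=> G degG sG; apply: sdiam3_order4 => //; rewrite card_ord.
- apply: (@maxdeg_list 4 _ 0 [:: 1; 2; 3]) => //.
    by move=> [|[|[|[|]]]].
  move=> k ltk.
  exists (nth [::] [:: [:: 1; 2; 3]; [:: 0; 2]; [:: 0; 1; 3]; [:: 0; 2]] k).
    by move: k ltk => [|[|[|[|]]]].
  by move: k ltk => [|[|[|[|]]]] // _ [|[|[|[|]]]].
- apply: (@sdiam_list 4 _ [:: 0; 1; 2; 3]) => // v.
  rewrite !inE => v4; split; first by lia.
  (* Both 0 and 2 are adjacent to all other vertices, so whichever is kept as root is the centre of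
     a spanning star. *)
  exists (if v == 0 then 2 else 0); first by lia_if.
  exists (fun i => if i == (if v == 0 then 2 else 0) then 0 else 1) => i lti iv ir.
  exists (if v == 0 then 2 else 0).
  by rewrite /list_adj !inE !xpair_eqE; split; lia_if.
- exact: card_list_edges.
Qed.

Lemma e3_3_5 : e3 5 3 3 = (5%:Z)%:E.
Proof.
(* The 4-cycle on 0, 1, 2, 3 with a pendant vertex 4 at 0; only 0 is a cut vertex. *)
pose s := [:: (0, 1); (1, 2); (2, 3); (0, 3); (0, 4)].
apply: (e3_eq (G := list_graph 5 s)).
- move=> G degG sG; have := @sdiam3_card_edges_gt _ G.
  by rewrite card_ord degG; apply.
- apply: (@maxdeg_list 5 _ 0 [:: 1; 3; 4]) => //.
    by move=> [|[|[|[|[|]]]]].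
  move=> k ltk.
  exists (nth [::] [:: [:: 1; 3; 4]; [:: 0; 2]; [:: 1; 3]; [:: 0; 2]; [:: 0]] k).
    by move: k ltk => [|[|[|[|[|]]]]].
  by move: k ltk => [|[|[|[|[|]]]]] // _ [|[|[|[|[|]]]]].
- apply: (@sdiam_list 5 _ [:: 1; 2; 3; 4]) => // v.
  rewrite !inE => v4; split; first by lia.
  exists 0; first by lia.
  exists (fun i => if i == 0 then 0 else (i == 2).+1) => i lti iv ir.
  (* Only 2 is not adjacent to the root 0; it is reached through 1, or through 3 when 1 is
     deleted. *)
  exists (if i == 2 then if v == 1 then 3 else 1 else 0).
  by rewrite /list_adj !inE !xpair_eqE; split; lia_if.
- exact: card_list_edges.
Qed.

Theorem theorem4p1 :
  (forall n : nat, 4 <= n -> e3 n 2 (n - 2) = (n%:Z)%:E)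
  /\ (forall n : nat, 4 <= n ->
        e3 n 3 (n - 2) =
          ((if n == 4 then n + 1 else if n == 5 then n else n - 1)%N%:Z)%:E)
  /\ (forall n l : nat, 5 <= n -> 4 <= l <= n - 1 ->
        e3 n l (n - 2) = ((n - 1)%N%:Z)%:E).
Proof.
split; first exact: e3_2.
split=> [n n4|n l _]; last exact: e3_ge4.
have [->|n_neq4] := eqVneq n 4; first exact: e3_3_4.
have [->|n_neq5] := eqVneq n 5; first exact: e3_3_5.
by apply: e3_3_ge6; lia.
Qed.
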